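(* Let $\mathbf{k}$ be a commutative ring with identity and let $(V,\alpha_V)$ be an involutive Hom-module over $\mathbf{k}$. Let $T^+_h(V)=\bigoplus_{n\ge 1}V^{\otimes n}$, with the linear operator $\alpha_T$, the binary operation $\odot$ and the inclusion $i_V:V\to T^+_h(V)$ defined in the context. Then: (1) The triple $(T^+_h(V),\odot,\alpha_T)$ is an involutive Hom-associative algebra. (2) The quadruple $(T^+_h(V),\odot,\alpha_T,i_V)$ is the free involutive Hom-associative algebra on $V$.
   Context: All modules, linear maps and tensor products are over $\mathbf{k}$. A Hom-module is a pair $(V,\alpha_V)$ with $V$ a $\mathbf{k}$-module and $\alpha_V:V\to V$ linear; it is involutive if $\alpha_V^2=\mathrm{id}$. A morphism of Hom-modules $f:(V,\alpha_V)\to(W,\alpha_W)$ is a linear map with $f\circ\alpha_V=\alpha_W\circ f$. A Hom-associative algebra is a triple $(A,\cdot,\alpha_A)$ with $A$ a $\mathbf{k}$-module, $\cdot:A\otimes A\to A$ linear, and $\alpha_A:A\to A$ linear, such that $\alpha_A(x\cdot y)=\alpha_A(x)\cdot\alpha_A(y)$ and $\alpha_A(x)\cdot(y\cdot z)=(x\cdot y)\cdot\alpha_A(z)$ for all $x,y,z\in A$ (no unit is required). It is involutive if $\alpha_A^2=\mathrm{id}$. A morphism of Hom-associative algebras is a linear map commuting with the multiplications and with the operators $\alpha$. A free involutive Hom-associative algebra on an involutive Hom-module $(V,\alpha_V)$ is an involutive Hom-associative algebra $(F,\ast,\alpha_F)$ together with a morphism of Hom-modules $j_V:(V,\alpha_V)\to(F,\alpha_F)$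 such that for any involutive Hom-associative algebra $(A,\cdot,\alpha_A)$ and any morphism of Hom-modules $f:(V,\alpha_V)\to(A,\alpha_A)$ there is a unique morphism of Hom-associative algebras $\bar f:(F,\ast,\alpha_F)\to(A,\cdot,\alpha_A)$ with $f=\bar f\circ j_V$. Construction: $T^+_h(V):=\bigoplus_{n\ge1}V^{\otimes n}$. The linear operator $\alpha_T$ on $T^+_h(V)$ is given by $\alpha_T(a_1\otimes\cdots\otimes a_n)=\alpha_V(a_1)\otimes\cdots\otimes\alpha_V(a_n)$. The bilinear operation $\odot$ on $T^+_h(V)$ is defined on pure tensors $\mathfrak a\in V^{\otimes m}$ and $\mathfrak b=b_1\otimes\cdots\otimes b_n\in V^{\otimes n}$ by induction on $n$: for $n=1$, $\mathfrak a\odot\mathfrak b:=\mathfrak a\otimes\mathfrak b$; and for $n=k+1$ with $k\ge1$, $\mathfrak a\odot\mathfrak b:=\big(\alpha_T(\mathfrak a)\odot(b_1\otimes\cdots\otimes b_k)\big)\otimes\alpha_T(b_{k+1})$. The map $i_V:V\to T^+_h(V)$ is the canonical inclusion onto the degree-one summand. *)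

(* Defs.v *)
From HB Require Import structures.
From mathcomp Require Import all_boot all_algebra ring_quotient generic_quotient.
From mathcomp Require Import boolp classical_sets functions cardinality fsbigop.

Set Implicit Arguments.
Unset Strict Implicit.
Unset Printing Implicit Defensive.

Import GRing.Theory.
Local Open Scope classical_set_scope.
Local Open Scope ring_scope.
Local Open Scope quotient_scope.


Section DirectSum.
(* comPzRingType, not comNzRingType: the base ring may be the zero ring. *)
Variables (k : comPzRingType) (I : choiceType) (E : I -> lmodType k).

Record dsum := DSum {
  dsum_val :> forall i, E i;
  dsum_fin : finite_set [set i | dsum_val i != 0] }.

HB.instance Definition _ := gen_eqMixin dsum.
HB.instance Definition _ := gen_choiceMixin dsum.

Lemma dsumP (x y : dsum) : (forall i, x i = y i) -> x = y.
Proof.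
case: x y => x hx [y hy] /= exyi.
have exy : x = y by exact: functional_extensionality_dep.
by subst y; congr DSum; exact: Prop_irrelevance.
Qed.

Lemma dsum0_fin : finite_set [set i | (0 : E i) != 0].
Proof. by apply: sub_finite_set (finite_set0 I) => i /=; rewrite eqxx. Qed.

Lemma dsumN_fin (x : dsum) : finite_set [set i | - x i != 0].
Proof.
by apply: sub_finite_set (dsum_fin x) => i /=; rewrite oppr_eq0.
Qed.

Lemma dsumD_fin (x y : dsum) : finite_set [set i | x i + y i != 0].
Proof.
have h : finite_set ([set i | x i != 0] `|` [set i | y i != 0]).
  by rewrite finite_setU; split; exact: dsum_fin.
apply: sub_finite_set h => i /=.
have [->|] := eqVneq (x i) 0; last by left.
by rewrite add0r; right.
Qed.

Lemma dsumZ_fin (c : k) (x : dsum) : finite_set [set i | c *: x i != 0].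
Proof.
apply: sub_finite_set (dsum_fin x) => i /=.
by apply: contra_neq => ->; rewrite scaler0.
Qed.

Let dsum0 := DSum dsum0_fin.
Let dsumN x := DSum (dsumN_fin x).
Let dsumD x y := DSum (dsumD_fin x y).
Let dsumZ c x := DSum (dsumZ_fin c x).

Fact dsum_addA : associative dsumD.
Proof. by move=> x y z; apply: dsumP => i /=; rewrite addrA. Qed.
Fact dsum_addC : commutative dsumD.
Proof. by move=> x y; apply: dsumP => i /=; rewrite addrC. Qed.
Fact dsum_add0 : left_id dsum0 dsumD.
Proof. by move=> x; apply: dsumP => i /=; rewrite add0r. Qed.
Fact dsum_addN : left_inverse dsum0 dsumN dsumD.
Proof. by move=> x; apply: dsumP => i /=; rewrite addNr. Qed.

HB.instance Definition _ :=
  GRing.isZmodule.Build dsum dsum_addA dsum_addC dsum_add0 dsum_addN.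

Fact dsum_scaleA c d x : dsumZ c (dsumZ d x) = dsumZ (c * d) x.
Proof. by apply: dsumP => i /=; rewrite scalerA. Qed.
Fact dsum_scale1 : left_id 1 dsumZ.
Proof. by move=> x; apply: dsumP => i /=; rewrite scale1r. Qed.
Fact dsum_scaleDr : right_distributive dsumZ +%R.
Proof. by move=> c x y; apply: dsumP => i /=; rewrite scalerDr. Qed.
Fact dsum_scaleDl x : {morph dsumZ^~ x : c d / c + d}.
Proof. by move=> c d; apply: dsumP => i /=; rewrite scalerDl. Qed.

HB.instance Definition _ := GRing.Zmodule_isLmodule.Build k dsum
  dsum_scaleA dsum_scale1 dsum_scaleDr dsum_scaleDl.

Lemma dsum0E i : (0 : dsum) i = 0. Proof. by []. Qed.
Lemma dsumDE (x y : dsum) i : (x + y) i = x i + y i. Proof. by []. Qed.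
Lemma dsumNE (x : dsum) i : (- x) i = - x i. Proof. by []. Qed.
Lemma dsumZE c (x : dsum) i : (c *: x) i = c *: x i. Proof. by []. Qed.

Definition dinj_val i (x : E i) j : E j :=
  match i =P j with ReflectT e => eq_rect i E x j e | ReflectF _ => 0 end.

Lemma dinj_val_eq i (x : E i) : dinj_val x i = x.
Proof.
by rewrite /dinj_val; case: eqP => // e; rewrite (eq_axiomK e).
Qed.

Lemma dinj_val_neq i (x : E i) j : i != j -> dinj_val x j = 0.
Proof. by rewrite /dinj_val; case: eqP. Qed.

Lemma dinj_fin i (x : E i) : finite_set [set j | dinj_val x j != 0].
Proof.
apply: sub_finite_set (finite_set1 i) => j /=.
by apply: contra_neqP => /eqP nji; rewrite dinj_val_neq // eq_sym.
Qed.

Definition dinj i (x : E i) : dsum := DSum (dinj_fin x).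

Lemma dinjE i (x : E i) : dinj x i = x.
Proof. exact: dinj_val_eq. Qed.

Lemma dinj_neq i (x : E i) j : i != j -> dinj x j = 0.
Proof. exact: dinj_val_neq. Qed.

Fact dinj_is_linear i : linear (@dinj i).
Proof.
move=> c x y; apply: dsumP => j; rewrite dsumDE dsumZE.
have [<-|nij] := eqVneq i j; first by rewrite !dinjE.
by rewrite !dinj_neq // scaler0 addr0.
Qed.
HB.instance Definition _ i :=
  GRing.isLinear.Build k (E i) dsum _ (@dinj i) (@dinj_is_linear i).

Section Lift.
Variables (P : lmodType k) (h : forall i, {linear E i -> P}).

Definition dsum_lift (x : dsum) : P := \sum_(i \in [set: I]) h i (x i).

Lemma dsum_lift_fin (x : dsum) :
  finite_set ([set: I] `&` (fun i => h i (x i)) @^-1` [set~ 0]).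
Proof.
apply: sub_finite_set (dsum_fin x) => i /= [_ hi]; apply/eqP => xi0.
by apply: hi; rewrite xi0 linear0.
Qed.

Lemma dsum_liftEw (A : set I) (x : dsum) :
  finite_set A -> [set i | x i != 0] `<=` A ->
  dsum_lift x = \sum_(i \in A) h i (x i).
Proof.
move=> finA sA; rewrite /dsum_lift; symmetry; apply: fsbig_widen => //.
move=> i [_ /= nAi]; have [->|xi] := eqVneq (x i) 0; first by rewrite linear0.
by case: nAi; exact: sA.
Qed.

Fact dsum_lift_is_linear : linear dsum_lift.
Proof.
move=> c x y.
set A := [set i | x i != 0] `|` [set i | y i != 0].
have finA : finite_set A by rewrite finite_setU; split; exact: dsum_fin.
have xA : [set i | x i != 0] `<=` A by move=> i; left.
have yA : [set i | y i != 0] `<=` A by move=> i; right.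
have xyA : [set i | (c *: x + y) i != 0] `<=` A.
  move=> i; change (c *: x i + y i != 0 -> A i).
  have [->|] := eqVneq (x i) 0; last by left.
  by rewrite scaler0 add0r; right.
rewrite (dsum_liftEw finA xA) (dsum_liftEw finA yA) (dsum_liftEw finA xyA).
rewrite !fsbig_finite //= scaler_sumr -big_split /=.
by apply: eq_bigr => i _; rewrite linearP.
Qed.
HB.instance Definition _ :=
  GRing.isLinear.Build k dsum P _ dsum_lift dsum_lift_is_linear.

Lemma dsum_lift_inj i (x : E i) : dsum_lift (dinj x) = h i x.
Proof.
rewrite (@dsum_liftEw [set i]) //; first by rewrite fsbig_set1 dinjE.
move=> j /=; apply: contra_neqP => /eqP nji.
by rewrite dinj_val_neq // eq_sym.
Qed.
End Lift.

Lemma dsum_sum (x : dsum) : x = dsum_lift (fun i => @dinj i) x.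
Proof.
have [r ur xr] : exists2 r : seq I, uniq r & forall i, i \notin r -> x i = 0.
  have [s ss] := (finite_seqP _).1 (dsum_fin x).
  exists (undup s); first exact: undup_uniq.
  move=> i; rewrite mem_undup => nis; apply/eqP; apply: contraNT nis => xi.
  have : [set i | x i != 0] i by [].
  by rewrite ss.
rewrite (@dsum_liftEw _ _ [set` r]) //; last first.
  by move=> i /=; apply: contraNT => /xr ->.
rewrite -fsbig_seq //; apply: dsumP => j.
rewrite (big_morph (fun y : dsum => y j) (id1 := 0) (op1 := +%R)) //.
have [jr|/xr xj0] := boolP (j \in r).
  rewrite (bigD1_seq j) //= dinj_val_eq big1 ?addr0 //.
  by move=> i nij; rewrite dinj_val_neq.
rewrite xj0 big1 // => i _ /=.
have [eij|nij] := eqVneq i j; last by rewrite dinj_val_neq.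
by subst i; rewrite dinj_val_eq.
Qed.

End DirectSum.

Section Tensor.
Variables (k : comPzRingType) (M N : lmodType k).

(* The free k-module on the set M * N. *)
Definition free_prod : lmodType k := dsum (fun _ : M * N => k^o : lmodType k).
Definition gen (x : M) (y : N) : free_prod :=
  @dinj k _ (fun _ : M * N => k^o : lmodType k) (x, y) (1 : k).

(* The submodule generated by the bilinearity relations. *)
Inductive tens_rel : free_prod -> Prop :=
| TensRelDl x x' y : tens_rel (gen (x + x') y - gen x y - gen x' y)
| TensRelDr x y y' : tens_rel (gen x (y + y') - gen x y - gen x y')
| TensRelZl c x y : tens_rel (gen (c *: x) y - c *: gen x y)
| TensRelZr c x y : tens_rel (gen x (c *: y) - c *: gen x y)
| TensRel0 : tens_rel 0
| TensRelD u v : tens_rel u -> tens_rel v -> tens_rel (u + v)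
| TensRelZ c u : tens_rel u -> tens_rel (c *: u).

Definition tens_ker : {pred free_prod} := fun u => `[< tens_rel u >].

Lemma tens_kerP u : reflect (tens_rel u) (u \in tens_ker).
Proof. exact: asboolP. Qed.

Fact tens_ker_zmod : zmod_closed tens_ker.
Proof.
split; first by apply/tens_kerP/TensRel0.
move=> u v /tens_kerP hu /tens_kerP hv; apply/tens_kerP.
by rewrite -scaleN1r; apply: TensRelD hu (TensRelZ _ hv).
Qed.
HB.instance Definition _ :=
  GRing.isZmodClosed.Build free_prod tens_ker tens_ker_zmod.

Definition tens := Quotient.quot tens_ker.
HB.instance Definition _ := GRing.Zmodule.on tens.
HB.instance Definition _ := EqQuotient.on tens.

Lemma tens_piE u v : tens_rel (u - v) <-> \pi_tens u = \pi_tens v.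
Proof.
split=> [h|/eqP].
  by apply/eqP; rewrite -(Quotient.idealrBE tens_ker); apply/tens_kerP.
by rewrite -(Quotient.idealrBE tens_ker) => /tens_kerP.
Qed.

Lemma tens_piD : {morph \pi_tens : u v / u + v}.
Proof. by move=> u v; rewrite (Quotient.pi_add tens_ker). Qed.

Lemma tens_piN : {morph \pi_tens : u / - u}.
Proof. by move=> u; rewrite (Quotient.pi_opp tens_ker). Qed.

Definition tens_scale (c : k) (x : tens) : tens := \pi_tens (c *: repr x).

Lemma tens_piZ c u : \pi_tens (c *: u) = tens_scale c (\pi_tens u).
Proof.
apply/tens_piE; rewrite -scalerBr; apply: TensRelZ.
by apply/tens_piE; rewrite reprK.
Qed.

Fact tens_scaleA c d x : tens_scale c (tens_scale d x) = tens_scale (c * d) x.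
Proof. by rewrite -[x]reprK -(tens_piZ d) -(tens_piZ c) -tens_piZ scalerA. Qed.
Fact tens_scale1 : left_id 1 tens_scale.
Proof. by move=> x; rewrite -[x]reprK -tens_piZ scale1r. Qed.
Fact tens_scaleDr : right_distributive tens_scale +%R.
Proof.
move=> c x y; rewrite -[x]reprK -[y]reprK.
by rewrite -tens_piD -(tens_piZ c (_ + _)) -!tens_piZ scalerDr tens_piD.
Qed.
Fact tens_scaleDl x : {morph tens_scale^~ x : c d / c + d}.
Proof. by move=> c d; rewrite -[x]reprK -!tens_piZ scalerDl tens_piD. Qed.

HB.instance Definition _ := GRing.Zmodule_isLmodule.Build k tens
  tens_scaleA tens_scale1 tens_scaleDr tens_scaleDl.

Lemma tens_pi_is_linear : linear (\pi_tens : free_prod -> tens).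
Proof. by move=> c u v; rewrite tens_piD tens_piZ. Qed.

Definition pure (x : M) (y : N) : tens := \pi_tens (gen x y).

Lemma pureDl x x' y : pure (x + x') y = pure x y + pure x' y.
Proof.
by rewrite /pure -tens_piD; apply/tens_piE; rewrite opprD addrA; exact: TensRelDl.
Qed.

Lemma pureDr x y y' : pure x (y + y') = pure x y + pure x y'.
Proof.
by rewrite /pure -tens_piD; apply/tens_piE; rewrite opprD addrA; exact: TensRelDr.
Qed.

Lemma pureZl c x y : pure (c *: x) y = c *: pure x y.
Proof. by rewrite /pure -[RHS]tens_piZ; apply/tens_piE; exact: TensRelZl. Qed.

Lemma pureZr c x y : pure x (c *: y) = c *: pure x y.
Proof. by rewrite /pure -[RHS]tens_piZ; apply/tens_piE; exact: TensRelZr. Qed.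

Fact pure_is_linear x : linear (pure x).
Proof. by move=> c y y'; rewrite pureDr pureZr. Qed.
HB.instance Definition _ x :=
  GRing.isLinear.Build k N tens _ (pure x) (pure_is_linear x).
End Tensor.

Lemma tens_ind (k : comPzRingType) (M N : lmodType k) (K : tens M N -> Prop) :
  (forall s t, K s -> K t -> K (s + t)) -> (forall x y, K (pure x y)) ->
  forall t, K t.
Proof.
move=> KD Kp t; rewrite -[t]reprK; move: (repr t) => u.
have K0 : K 0 by have := Kp 0 0; rewrite -(scale0r (0 : M)) pureZl scale0r.
rewrite [u]dsum_sum /dsum_lift.
elim: (finite_support _ _ _) => [|[x y] r IH].
  rewrite big_nil; suff -> : \pi_(tens M N) 0 = 0 :> tens M N by [].
  by apply: (addrI (\pi_(tens M N) 0)); rewrite -tens_piD !addr0.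
rewrite big_cons tens_piD; apply: KD IH.
have e : dinj (u (x, y)) = u (x, y) *: gen x y :> free_prod M N.
  by rewrite /gen -linearZ; congr dinj; exact/esym/mulr1.
apply: (eq_ind_r (fun v => K (\pi_(tens M N) v)) _ e).
by rewrite tens_piZ; have := Kp (u (x, y) *: x) y; rewrite pureZl.
Qed.

Definition bilinear_map (k : comPzRingType) (M N P : lmodType k)
    (f : M -> N -> P) : Prop :=
  (forall x, linear (f x)) /\ (forall y, linear (f^~ y)).

Section TensorLift.
Variables (k : comPzRingType) (M N P : lmodType k) (f : M -> N -> P).
Hypothesis f_bilin : bilinear_map f.

Definition gen_value (p : M * N) (c : k^o) : P := (c : k) *: f p.1 p.2.

Fact gen_value_is_linear p : linear (gen_value p).
Proof. by move=> c a b; rewrite /gen_value scalerDl scalerA. Qed.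
HB.instance Definition _ p :=
  GRing.isLinear.Build k (k^o : lmodType k) P _ (gen_value p)
    (gen_value_is_linear p).

Definition free_lift : free_prod M N -> P :=
  dsum_lift (fun p => gen_value p).
HB.instance Definition _ := GRing.Linear.on free_lift.

Lemma free_lift_gen x y : free_lift (gen x y) = f x y.
Proof. by rewrite /free_lift /gen dsum_lift_inj /= /gen_value scale1r. Qed.

Lemma free_lift_rel u : tens_rel u -> free_lift u = 0.
Proof.
case: f_bilin => fr fl; elim=> {u}.
- move=> x x' y; rewrite !linearB /= !free_lift_gen.
  have := fl y 1 x x'; rewrite !scale1r => ->.
  by rewrite -addrA -opprD subrr.
- move=> x y y'; rewrite !linearB /= !free_lift_gen.
  have := fr x 1 y y'; rewrite !scale1r => ->.
  by rewrite -addrA -opprD subrr.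
- move=> c x y; rewrite linearB linearZ /= !free_lift_gen.
  have f0 : f 0 y = 0.
    have := fl y 1 0 0; rewrite !scale1r addr0 => /esym/eqP.
    by rewrite -subr_eq0 addrK => /eqP.
  have := fl y c x 0; rewrite f0 !addr0 => ->.
  by rewrite subrr.
- move=> c x y; rewrite linearB linearZ /= !free_lift_gen.
  have f0 : f x 0 = 0.
    have := fr x 1 0 0; rewrite !scale1r addr0 => /esym/eqP.
    by rewrite -subr_eq0 addrK => /eqP.
  have := fr x c y 0; rewrite f0 !addr0 => ->.
  by rewrite subrr.
- by rewrite linear0.
- by move=> u v _ hu _ hv; rewrite linearD /= hu hv addr0.
- by move=> c u _ hu; rewrite linearZ /= hu scaler0.
Qed.

Definition tens_lift (t : tens M N) : P := free_lift (repr t).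

Lemma tens_lift_pi u : tens_lift (\pi_(tens M N) u) = free_lift u.
Proof.
apply/eqP; rewrite -subr_eq0 -linearB; apply/eqP/free_lift_rel.
by apply/tens_piE; rewrite reprK.
Qed.

Lemma tens_lift_pure x y : tens_lift (pure x y) = f x y.
Proof. by rewrite tens_lift_pi free_lift_gen. Qed.

Lemma tens_lift_is_linear : linear tens_lift.
Proof.
move=> c s t; rewrite -[s]reprK -[t]reprK -tens_pi_is_linear.
by rewrite !tens_lift_pi linearP.
Qed.
End TensorLift.

Section TensorMap.
Variables (k : comPzRingType) (M N M' N' : lmodType k).
Variables (g : {linear M -> M'}) (h : {linear N -> N'}).

Definition tens_map : tens M N -> tens M' N' :=
  tens_lift (fun x y => pure (g x) (h y)).

Fact tens_map_bilinear : bilinear_map (fun x y => pure (g x) (h y)).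
Proof.
split=> [x|y] c u v; first by rewrite !linearP.
by rewrite linearP pureDl pureZl.
Qed.

HB.instance Definition _ := GRing.isLinear.Build k (tens M N) (tens M' N') _
  tens_map (tens_lift_is_linear tens_map_bilinear).

Lemma tens_map_pure x y : tens_map (pure x y) = pure (g x) (h y).
Proof. by rewrite /tens_map (tens_lift_pure tens_map_bilinear). Qed.
End TensorMap.

Section TensorPowers.
Variables (k : comPzRingType) (V : lmodType k).

(* Index shift: tpow n is the tensor power of exponent n + 1, bracketed as
   (...(V (x) V) (x) ...) (x) V. Hence the product of degrees m + 1 and n + 1
   lands in tpow (n + m).+1, and n + m (in this order) makes the recursion on n
   in thmul go through without casts. *)
Fixpoint tpow (n : nat) : lmodType k :=
  if n is m.+1 then tens (tpow m) V else V.

Definition Tplus : lmodType k := dsum tpow.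

Definition tinj (n : nat) : {linear tpow n -> Tplus} := @dinj k nat tpow n.

Definition iV : {linear V -> Tplus} := tinj 0.

Variable alphaV : {linear V -> V}.

Fixpoint talpha (n : nat) : {linear tpow n -> tpow n} :=
  if n is m.+1 then
    tens_map (talpha m) alphaV : {linear tens (tpow m) V -> tens (tpow m) V}
  else alphaV.

(* The component of odot on tensor powers; thmul0 and thmulS are its defining
   induction on pure tensors. *)
Fixpoint thmul (m n : nat) :
    tpow m -> {linear tpow n -> tpow (n + m).+1} :=
  match n return tpow m -> {linear tpow n -> tpow (n + m).+1} with
  | 0 => fun a => pure a : {linear V -> tens (tpow m) V}
  | n'.+1 => fun a => tens_map (thmul n' (talpha m a)) alphaV
         : {linear tens (tpow n') V -> tens (tpow (n' + m).+1) V}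
  end.

Lemma talpha0 (a : V) : talpha 0 a = alphaV a. Proof. by []. Qed.
Lemma talphaS n (a : tpow n) (b : V) :
  talpha n.+1 (pure a b) = pure (talpha n a) (alphaV b).
Proof. exact: tens_map_pure. Qed.

Lemma thmul0 m (a : tpow m) (b : V) : thmul 0 a b = pure a b.
Proof. by []. Qed.
Lemma thmulS m n (a : tpow m) (b : tpow n) (c : V) :
  thmul n.+1 a (pure b c) = pure (thmul n (talpha m a) b) (alphaV c).
Proof. exact: tens_map_pure. Qed.

Lemma thmul0l m n (b : tpow n) : thmul n (0 : tpow m) b = 0.
Proof.
elim: n b => [|n IH] b.
  by have /esym := pureZl 0 (0 : tpow m) (b : V); rewrite !scale0r.
elim/tens_ind: b => [u v hu hv|b c].
  by rewrite linearD hu hv addr0.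
by rewrite thmulS linear0 IH -(scale0r (0 : tpow (n + m).+1)) pureZl scale0r.
Qed.

Definition alphaT : {linear Tplus -> Tplus} :=
  dsum_lift (fun n => tinj n \o talpha n : {linear tpow n -> Tplus}).

(* Only finitely many terms are nonzero; by odot_tinj this is the biadditive
   extension of thmul. *)
Definition odot (x y : Tplus) : Tplus :=
  \sum_(m \in [set: nat]) \sum_(n \in [set: nat])
    tinj (n + m).+1 (thmul n (x m) (y n)).

Lemma alphaT_tinj n (a : tpow n) : alphaT (tinj n a) = tinj n (talpha n a).
Proof. exact: dsum_lift_inj. Qed.

Lemma odot_tinj m n (a : tpow m) (b : tpow n) :
  odot (tinj m a) (tinj n b) = tinj (n + m).+1 (thmul n a b).
Proof.
have sum1 (F : nat -> Tplus) j : (forall i, j != i -> F i = 0) ->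
    \sum_(i \in [set: nat]) F i = F j.
  move=> F0; rewrite -(fsbig_widen [set j]) ?fsbig_set1 // => i [_ /=] nij.
  by apply: F0; apply/eqP => ij; apply: nij.
rewrite /odot (sum1 _ m) => [|i nmi].
  rewrite (sum1 _ n) => [|i nni]; first by rewrite /= !dinj_val_eq.
  by rewrite [tinj n b i]dinj_neq // !linear0.
rewrite fsbig1 // => j _.
by rewrite [tinj m a i]dinj_neq // thmul0l linear0.
Qed.

End TensorPowers.

Section HomAlgebras.
Variable k : comPzRingType.

Definition hom_module_morphism (V W : lmodType k)
    (alphaV : {linear V -> V}) (alphaW : {linear W -> W})
    (f : {linear V -> W}) : Prop :=
  forall x, f (alphaV x) = alphaW (f x).

Definition hom_associative_algebra (A : lmodType k)
    (mul : A -> A -> A) (alpha : {linear A -> A}) : Prop :=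
  [/\ bilinear_map mul,
      {morph alpha : x y / mul x y} &
      forall x y z, mul (alpha x) (mul y z) = mul (mul x y) (alpha z)].

Definition involutive_hom_associative_algebra (A : lmodType k)
    (mul : A -> A -> A) (alpha : {linear A -> A}) : Prop :=
  hom_associative_algebra mul alpha /\ involutive alpha.

Definition hom_algebra_morphism (A B : lmodType k)
    (mulA : A -> A -> A) (alphaA : {linear A -> A})
    (mulB : B -> B -> B) (alphaB : {linear B -> B})
    (g : {linear A -> B}) : Prop :=
  {morph g : x y / mulA x y >-> mulB x y} /\
  hom_module_morphism alphaA alphaB g.

Definition free_involutive_hom_associative_algebra
    (V : lmodType k) (alphaV : {linear V -> V})
    (F : lmodType k) (mulF : F -> F -> F) (alphaF : {linear F -> F})
    (j : {linear V -> F}) : Prop :=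
  [/\ involutive_hom_associative_algebra mulF alphaF,
      hom_module_morphism alphaV alphaF j &
      forall (A : lmodType k) (mulA : A -> A -> A) (alphaA : {linear A -> A}),
        involutive_hom_associative_algebra mulA alphaA ->
      forall f : {linear V -> A}, hom_module_morphism alphaV alphaA f ->
      exists2 g : {linear F -> A},
        hom_algebra_morphism mulF alphaF mulA alphaA g /\ f =1 g \o j &
        forall g' : {linear F -> A},
          hom_algebra_morphism mulF alphaF mulA alphaA g' -> f =1 g' \o j ->
          g' =1 g].

End HomAlgebras.

(* Main.v *)
Require Import Defs.
From HB Require Import structures.
From mathcomp Require Import all_boot all_algebra.

Set Implicit Arguments.
Unset Strict Implicit.
Unset Printing Implicit Defensive.

Import GRing.Theory.
Local Open Scope ring_scope.

(** Write [(.)] for the product [odot] and [v] also for the image [iV v] of a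
    letter [v : V] in degree one.  Appending a letter on
    the right is the product [x (.) v], so every element of the tensor module
    is a sum of left-normed products of letters, and the inductive definition
    of the product becomes a single identity between elements,
    [x (.) (y (.) v) = (alpha x (.) y) (.) alpha v].
    From there on degrees play no part: each claim about [x (.) y] is proved by
    induction on [y] from the two cases [y = v] and [y = y' (.) v]
    ([Tplus_word_ind]), all maps involved being linear.

    Hom-associativity for [z = v] is the displayed identity at [alpha x], since
    [alpha (alpha x) = x]; for [z = z' (.) v] both sides reduce by that identity
    and multiplicativity of [alpha] to the case of [alpha x], [alpha y], [z'].

    For freeness, a morphism extending [f] has to send [x (.) v] to
    [g x * f v], which proves uniqueness and also defines [g] degree by degree.
    Such a [g] is multiplicative because Hom-associativity and involutivity of
    the target make its product obey the same displayed identity. *)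

Section Bilinear.
Variables (k : comPzRingType) (M N P : lmodType k) (f : M -> N -> P).
Hypothesis f_bilin : bilinear_map f.

Lemma bilinearDl y : {morph f^~ y : x x' / x + x'}.
Proof.
by move=> x x'; have := f_bilin.2 y 1 x x'; rewrite !scale1r.
Qed.

Lemma bilinearDr x : {morph f x : y y' / y + y'}.
Proof.
by move=> y y'; have := f_bilin.1 x 1 y y'; rewrite !scale1r.
Qed.

Definition tens_lift_linear : {linear tens M N -> P} :=
  HB.pack (tens_lift f) (GRing.isLinear.Build k (tens M N) P _ (tens_lift f)
    (tens_lift_is_linear f_bilin)).

Lemma tens_lift_linear_pure x y : tens_lift_linear (pure x y) = f x y.
Proof. exact: tens_lift_pure. Qed.

End Bilinear.

Section Algebra.
Variables (k : comPzRingType) (V : lmodType k) (alphaV : {linear V -> V}).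

Local Notation T := (Tplus V).
Local Notation "x (.) y" := (odot alphaV x y) (at level 40, left associativity).
Local Notation al := (alphaT alphaV).

Lemma Tplus_homog_ind (K : T -> Prop) :
  (forall x y, K x -> K y -> K (x + y)) ->
  (forall n (a : tpow V n), K (tinj V n a)) -> forall x, K x.
Proof.
move=> KD Kt x; rewrite [x]dsum_sum /dsum_lift.
apply: big_ind => [||n _]; [|exact: KD|exact: Kt].
by have := Kt 0 0; rewrite linear0.
Qed.

Lemma thmul_linearl m n (b : tpow V n) :
  linear (fun a : tpow V m => thmul alphaV n a b).
Proof.
elim: n b => [|n IH] b c a a'; first by rewrite /= pureDl pureZl.
elim/tens_ind: b => [u v hu hv|b v].
  by rewrite !linearD hu hv addrACA.
by rewrite !thmulS linearP IH pureDl pureZl.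
Qed.

(** The inner sum of [odot]: left multiplication by a homogeneous element. *)
Definition homog_mul m (a : tpow V m) : {linear T -> T} :=
  dsum_lift (fun n =>
    tinj V (n + m).+1 \o thmul alphaV n a : {linear tpow V n -> T}).

Definition homog_mulr (y : T) m (a : tpow V m) : T := homog_mul a y.

Lemma homog_mulr_linear (y : T) m : linear (@homog_mulr y m).
Proof.
rewrite /homog_mulr => c a a'.
elim/Tplus_homog_ind: y => [x y hx hy|n b].
  by rewrite !linearD hx hy addrACA.
by rewrite /homog_mul /= !dsum_lift_inj /= thmul_linearl linearP.
Qed.

HB.instance Definition _ (y : T) m :=
  GRing.isLinear.Build k (tpow V m) T _ (@homog_mulr y m)
    (@homog_mulr_linear y m).

(** The two nested sums of [odot] are iterated universal maps out of the direct
    sum, hence linear in either argument. *)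
Lemma odot_lift (x y : T) : x (.) y = dsum_lift (@homog_mulr y) x.
Proof. by []. Qed.

Lemma odot_bilinear : bilinear_map (odot alphaV).
Proof.
split=> [x|y] c u v; last by rewrite !odot_lift linearP.
elim/Tplus_homog_ind: x => [x y|m a].
  by rewrite !odot_lift !linearD /= => -> ->; rewrite addrACA.
by rewrite !odot_lift !dsum_lift_inj /= /homog_mulr linearP.
Qed.

Let odotDl := bilinearDl odot_bilinear.
Let odotDr := bilinearDr odot_bilinear.

Lemma tinj_pure n (b : tpow V n) (v : V) :
  tinj V n.+1 (pure b v) = tinj V n b (.) iV V v.
Proof. by rewrite odot_tinj. Qed.

(** Appending a letter is a product by [tinj_pure], so induction on the degree
    becomes induction on the last letter, with no degree in sight. *)
Lemma Tplus_word_ind (K : T -> Prop) :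
  (forall x y, K x -> K y -> K (x + y)) -> (forall v, K (iV V v)) ->
  (forall x v, K x -> K (x (.) iV V v)) -> forall x, K x.
Proof.
move=> KD Kv KS; elim/Tplus_homog_ind => // n; elim: n => [|n IH] a.
  exact: Kv.
elim/tens_ind: a => [s t hs ht|b v]; first by rewrite linearD; exact: KD.
by rewrite tinj_pure; apply: KS.
Qed.

Lemma alphaT_iV v : al (iV V v) = iV V (alphaV v).
Proof. exact: alphaT_tinj. Qed.

Lemma alphaT_odot_iV x v : al (x (.) iV V v) = al x (.) iV V (alphaV v).
Proof.
elim/Tplus_homog_ind: x => [x y hx hy|n a].
  by rewrite odotDl !linearD hx hy odotDl.
by rewrite -tinj_pure !alphaT_tinj talphaS tinj_pure.
Qed.

(** The inductive definition of the product, freed of degrees. *)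
Lemma odot_odot_iV x y v :
  x (.) (y (.) iV V v) = (al x (.) y) (.) iV V (alphaV v).
Proof.
elim/Tplus_homog_ind: x => [x x' hx hx'|m a].
  by rewrite linearD !odotDl hx hx'.
elim/Tplus_homog_ind: y => [y y' hy hy'|n b].
  by rewrite odotDl !odotDr odotDl hy hy'.
by rewrite -tinj_pure alphaT_tinj !odot_tinj thmulS -odot_tinj.
Qed.

Lemma alphaT_odot : {morph al : x y / x (.) y}.
Proof.
move=> x y; elim/Tplus_word_ind: y x => [y y' hy hy'|v|y v hy] x.
- by rewrite odotDr !linearD hy hy' odotDr.
- by rewrite alphaT_odot_iV alphaT_iV.
- by rewrite odot_odot_iV (alphaT_odot_iV y) alphaT_odot_iV hy -odot_odot_iV.
Qed.

Hypothesis alphaV_invol : involutive alphaV.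

Lemma alphaT_involutive : involutive al.
Proof.
elim/Tplus_word_ind => [x y hx hy|v|x v hx]; first by rewrite !linearD hx hy.
  by rewrite !alphaT_iV alphaV_invol.
by rewrite !alphaT_odot_iV hx alphaV_invol.
Qed.

(** Involutivity enters when [z] is a letter: moving it out of the right
    factor twists [alpha x] a second time, which has to give back [x]. *)
Lemma odot_hom_assoc x y z : al x (.) (y (.) z) = (x (.) y) (.) al z.
Proof.
elim/Tplus_word_ind: z x y => [z z' hz hz'|v|z v hz] x y.
- by rewrite linearD !odotDr hz hz'.
- by rewrite odot_odot_iV alphaT_involutive alphaT_iV.
- rewrite (odot_odot_iV y) (odot_odot_iV (al x)) hz.
  by rewrite (alphaT_odot_iV z) odot_odot_iV alphaT_odot.
Qed.

Lemma odot_involutive_hom_assoc :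
  involutive_hom_associative_algebra (odot alphaV) al.
Proof.
split; last exact: alphaT_involutive.
by split; [exact: odot_bilinear | exact: alphaT_odot | exact: odot_hom_assoc].
Qed.

Section Extension.
Variables (A : lmodType k) (mulA : A -> A -> A) (alphaA : {linear A -> A}).
Hypothesis A_alg : involutive_hom_associative_algebra mulA alphaA.
Variable f : {linear V -> A}.
Hypothesis f_alpha : hom_module_morphism alphaV alphaA f.

Let mulA_bilin : bilinear_map mulA. Proof. by case: A_alg => -[]. Qed.
Let alphaAM : {morph alphaA : x y / mulA x y}. Proof. by case: A_alg => -[]. Qed.
Let mulA_hom_assoc x y z :
  mulA (alphaA x) (mulA y z) = mulA (mulA x y) (alphaA z).
Proof. by case: A_alg => -[]. Qed.
Let alphaA_invol : involutive alphaA. Proof. by case: A_alg. Qed.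
Let mulADl := bilinearDl mulA_bilin.
Let mulADr := bilinearDr mulA_bilin.

Lemma append_bilinear (M : lmodType k) (g : {linear M -> A}) :
  bilinear_map (fun x v => mulA (g x) (f v)).
Proof.
split=> [x|v] c u w; rewrite linearP; first exact: mulA_bilin.1.
exact: mulA_bilin.2.
Qed.

(** A word [v0 (x) v1 (x) ... (x) vn] goes to the left-normed product
    [(... (f v0 * f v1) ...) * f vn]. *)
Fixpoint tpow_ext n : {linear tpow V n -> A} :=
  if n is n'.+1 then tens_lift_linear (append_bilinear (tpow_ext n')) else f.

Definition word_ext : {linear T -> A} := dsum_lift tpow_ext.

Lemma word_ext_iV v : word_ext (iV V v) = f v.
Proof. exact: (dsum_lift_inj tpow_ext (i := 0) v). Qed.

Lemma word_ext_odot_iV x v : word_ext (x (.) iV V v) = mulA (word_ext x) (f v).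
Proof.
elim/Tplus_homog_ind: x => [x y hx hy|n a].
  by rewrite odotDl !linearD hx hy mulADl.
by rewrite -tinj_pure /word_ext /= !dsum_lift_inj tens_lift_linear_pure.
Qed.

Lemma word_ext_alpha : hom_module_morphism al alphaA word_ext.
Proof.
elim/Tplus_word_ind => [x y hx hy|v|x v hx].
- by rewrite !linearD hx hy.
- by rewrite alphaT_iV !word_ext_iV f_alpha.
- by rewrite alphaT_odot_iV !word_ext_odot_iV hx f_alpha alphaAM.
Qed.

(** In the target, [a (b c) = (alpha a b) (alpha c)] since
    [a = alpha (alpha a)]; this is the recursion that computes the product of
    words. *)
Lemma word_extM : {morph word_ext : x y / x (.) y >-> mulA x y}.
Proof.
move=> x y; elim/Tplus_word_ind: y x => [y y' hy hy'|v|y v hy] x.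
- by rewrite odotDr !linearD hy hy' mulADr.
- by rewrite word_ext_odot_iV word_ext_iV.
- rewrite odot_odot_iV (word_ext_odot_iV (al x (.) y)) (word_ext_odot_iV y).
  rewrite hy (word_ext_alpha x) f_alpha.
  by rewrite -mulA_hom_assoc alphaA_invol.
Qed.

Lemma odot_morphism_unique (g g' : {linear T -> A}) :
  {morph g : x y / x (.) y >-> mulA x y} ->
  {morph g' : x y / x (.) y >-> mulA x y} ->
  (forall v, g (iV V v) = g' (iV V v)) -> g =1 g'.
Proof.
move=> gM g'M gg'; elim/Tplus_word_ind => // [x y hx hy|x v hx].
  by rewrite !linearD hx hy.
by rewrite gM g'M hx gg'.
Qed.

End Extension.
End Algebra.

Theorem theorem2p4 (k : comPzRingType) (V : lmodType k)
    (alphaV : {linear V -> V}) (alphaV_invol : involutive alphaV) :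
  involutive_hom_associative_algebra (odot alphaV) (alphaT alphaV) /\
  free_involutive_hom_associative_algebra
    alphaV (odot alphaV) (alphaT alphaV) (iV V).
Proof.
have T_alg := odot_involutive_hom_assoc alphaV_invol.
split=> //; split=> // [v|A mulA alphaA A_alg f f_alpha].
  by rewrite alphaT_iV.
exists (word_ext A_alg f) => [|g' [g'M _] fg'].
  split; last by move=> v; rewrite /= word_ext_iV.
  by split; [exact: word_extM | exact: word_ext_alpha].
apply: odot_morphism_unique g'M (word_extM A_alg f_alpha) _ => v.
by rewrite word_ext_iV fg'.
Qed.
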